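(* Let $A_2=\mathbb{Z}\alpha\oplus\mathbb{Z}\beta$ be the root lattice of type $A_2$, with $(\alpha|\alpha)=(\beta|\beta)=2$ and $(\alpha|\beta)=-1$, and let $P=\mathbb{Z}\alpha\oplus\mathbb{Z}_{\ge0}\beta$, a parabolic-type submonoid of $A_2$. Then the subVOA $V_P$ of $V_{A_2}$ is $C_1$-cofinite.
   Context: Lattice VOA. For a positive-definite even lattice $L$ put $\mathfrak{h}=\mathbb{C}\otimes_{\mathbb{Z}}L$ with the $\mathbb{C}$-bilinear extension of $(\cdot|\cdot)$, and $\hat{\mathfrak{h}}=\mathfrak{h}\otimes\mathbb{C}[t,t^{-1}]\oplus\mathbb{C}K$ with $K$ central, $h(m)=h\otimes t^m$, $[h_1(m),h_2(n)]=m\delta_{m+n,0}(h_1|h_2)K$. For $\lambda\in\mathfrak{h}$, $M_{\hat{\mathfrak{h}}}(1,\lambda)=U(\hat{\mathfrak{h}})\otimes_{U(\hat{\mathfrak{h}}_{\ge 0})}\mathbb{C}e^\lambda$, where $\hat{\mathfrak{h}}_{\ge 0}=\mathfrak{h}\otimes\mathbb{C}[t]\oplus\mathbb{C}K$ acts by $K=1$, $h(0)e^\lambda=(h|\lambda)e^\lambda$, $h(n)e^\lambda=0$ for $n>0$. Let $\epsilon:L\times L\to\{\pm1\}$ be a 2-cocycle with $\epsilon(\alpha,\beta)\epsilon(\beta,\alpha)=(-1)^{(\alpha|\beta)}$ and $\epsilon(0,\alpha)=\epsilon(\alpha,0)=1$. The lattice VOA is $V_L=\bigoplus_{\alpha\in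 L}M_{\hat{\mathfrak{h}}}(1,\alpha)=M_{\hat{\mathfrak{h}}}(1,0)\otimes\mathbb{C}^\epsilon[L]$ with vacuum $\mathbf{1}=e^0$, $Y(h(-1)\mathbf{1},z)=\sum_{n}h(n)z^{-n-1}$, $Y(e^\alpha,z)=\exp\big(\sum_{n>0}\frac{\alpha(-n)}{n}z^n\big)\exp\big(-\sum_{n>0}\frac{\alpha(n)}{n}z^{-n}\big)e_\alpha z^\alpha$, where $e_\alpha(w\otimes e^\beta)=\epsilon(\alpha,\beta)w\otimes e^{\alpha+\beta}$ and $z^\alpha$ acts on $M_{\hat{\mathfrak{h}}}(1,\beta)$ as $z^{(\alpha|\beta)}$; $Y$ of a general $h_1(-n_1-1)\cdots h_k(-n_k-1)e^\alpha$ is the normally ordered product of the $\frac{1}{n_i!}\partial_z^{n_i}h_i(z)$ and $Y(e^\alpha,z)$. The Virasoro element is $\omega=\frac12\sum_i u_i(-1)^2\mathbf{1}$ for an orthonormal basis $\{u_i\}$ of $\mathfrak{h}$; the weight of $h_1(-n_1)\cdots h_k(-n_k)e^\alpha$ is $n_1+\cdots+n_k+(\alpha|\alpha)/2$. For a submonoid $M\le L$ (a subset containing $0$ and closed under addition), $V_M=\bigoplus_{\gamma\in M}M_{\hat{\mathfrak{h}}}(1,\gamma)$ is a subVOA of $V_L$ with the same vacuum and Virasoro element. A submonoid $B\le L$ is of Borel-type if $B\cup(-B)=L$, $B\cap(-B)=\{0\}$, and $B$ lies in a closed half-space $\{v:(\gamma|v)\ge0\}$, $\gamma\ne0$; a submonoid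 is of parabolic-type if it contains a Borel-type submonoid. For a CFT-type VOA $V=\mathbb{C}\mathbf{1}\oplus V_+$, $V_+=\bigoplus_{n\ge1}V_n$, with $Y(a,z)=\sum_n a_nz^{-n-1}$, $C_1(V)=\mathrm{span}\{a_{-1}b:a,b\in V_+\}+\mathrm{span}\{L(-1)v:v\in V_+\}$, and $V$ is $C_1$-cofinite if $\dim V/C_1(V)<\infty$. *)

(* Defs.v *)
From HB Require Import structures.
From mathcomp Require Import all_boot all_order all_algebra finmap multiset.
From mathcomp Require Import complex.
From mathcomp Require Import boolp classical_sets functions cardinality fsbigop.
From mathcomp Require Import reals ring zify.
From mathcomp.multinomials Require Import monalg.

Set Implicit Arguments.
Unset Strict Implicit.
Unset Printing Implicit Defensive.

Import Order.TTheory GRing.Theory Num.Theory.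
Local Open Scope classical_set_scope.
Local Open Scope ring_scope.

(* A lattice of rank r is Z^r = 'rV[int]_r, written in a Z-basis a_0, ...,    *)
(* a_(r-1), with the form given by its Gram matrix G.  For a ring K, K (x) L  *)
(* is 'rV[K]_r and gform K G is the K-bilinear extension of the form.         *)
Definition gform (K : pzRingType) r (G : 'M[int]_r) (x y : 'rV[K]_r) : K :=
  (x *m map_mx intr G *m y^T) 0 0.

Record evenLattice (r : nat) := EvenLattice {
  gram : 'M[int]_r;
  gram_sym : gram^T = gram;
  gram_pos : forall v : 'rV[int]_r, v != 0 -> 0 < gform gram v v;
  gram_even : forall v : 'rV[int]_r, (2 %| gform gram v v)%Z
}.

Definition lform r (L : evenLattice r) (K : pzRingType) (x y : 'rV[K]_r) : K :=
  gform (gram L) x y.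

Definition lemb (K : pzRingType) r (a : 'rV[int]_r) : 'rV[K]_r := map_mx intr a.

Section Submonoids.
Variables (R : realType) (r : nat) (L : evenLattice r).
Implicit Types (B M : set 'rV[int]_r).

Definition submonoid M := M 0 /\ forall x y, M x -> M y -> M (x + y).

Definition borel_type B :=
  [/\ submonoid B,
      B `|` [set - x | x in B] = [set: 'rV[int]_r],
      B `&` [set - x | x in B] = [set 0]
    & exists2 g : 'rV[R]_r, g != 0 &
        forall v, B v -> 0 <= lform L g (lemb R v)].

Definition parabolic_type M :=
  submonoid M /\ exists2 B, borel_type B & B `<=` M.

End Submonoids.

Definition is_cocycle r (L : evenLattice r)
    (eps : 'rV[int]_r -> 'rV[int]_r -> int) :=
  [/\ forall a b, eps a b = 1 \/ eps a b = -1,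
      forall a b c, eps a b * eps (a + b) c = eps a (b + c) * eps b c,
      forall a b, eps a b * eps b a = (-1) ^ (lform L a b)
    & forall a, eps 0 a = 1 /\ eps a 0 = 1].

(* The PBW basis of V_L: the key (m, g) stands for                            *)
(*   a_(i_1)(-n_1 - 1) ... a_(i_k)(-n_k - 1) e^g,                             *)
(* m being the multiset of the pairs (i_j, n_j).  The opaque choice structure *)
(* keeps unification in {malg C[vkey r]} from unfolding that of the fields.   *)
Record vkey (r : nat) := VKey {
  osc : {mset ('I_r * nat)%type}%mset;
  mom : 'rV[int]_r
}.
HB.instance Definition _ r := gen_eqMixin (vkey r).
HB.instance Definition _ r := gen_choiceMixin (vkey r).

Notation lvect C r := {malg C[vkey r]}.

HB.lock Definition linext (C : fieldType) (K : choiceType) (W : lmodType C)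
    (f : K -> W) (v : {malg C[K]}) : W :=
  \sum_(k <- msupp v) v@_k *: f k.

(* Formal series in z, z^-1 with coefficients in the endomorphisms of V:      *)
(* A p is the coefficient of z^p.  Infinite sums are the sums \sum_(_ \in _)  *)
(* of families of finite support; every sum below has finite support when     *)
(* applied to a vector of V_L.                                                *)
Section FormalSeries.
Variables (C : fieldType) (V : lmodType C).
Definition fseries := int -> V -> V.
Implicit Types A B : fseries.

Definition fone : fseries := fun p v => if p == 0 then v else 0.

Definition fmul A B : fseries :=
  fun p v => \sum_(q \in [set: int]) A q (B (p - q) v).

Definition fexp A : fseries :=
  fun p v => \sum_(j \in [set: nat]) (j`!%:R)^-1 *: iter j (fmul A) fone p v.

Definition fderiv A : fseries := fun p v => (p + 1)%:~R *: A (p + 1) v.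

Definition fdivderiv n A : fseries :=
  fun p v => (n`!%:R)^-1 *: iter n fderiv A p v.

(* :A(z)B(z): = A(z)_+ B(z) + B(z) A(z)_-, where A(z)_+ (resp. A(z)_-)        *)
(* collects the non-negative (resp. negative) powers of z, that is, the modes *)
(* A_n with n < 0 (resp. n >= 0) of A(z) = \sum_n A_n z^(-n-1).               *)
Definition nord A B : fseries := fun p v =>
  fmul (fun q w => if 0 <= q then A q w else 0) B p v +
  fmul B (fun q w => if q < 0 then A q w else 0) p v.

End FormalSeries.

Section LatticeVOA.
Variables (C : fieldType) (r : nat) (L : evenLattice r).
Variable eps : 'rV[int]_r -> 'rV[int]_r -> int.
Local Notation V := (lvect C r).
Implicit Types (h : 'rV[C]_r) (a : 'rV[int]_r) (v w : V).

Definition hbasis (i : 'I_r) : 'rV[C]_r := delta_mx 0 i.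

Definition vexp a : V := << VKey mset0 a >>.

Definition vac : V := vexp 0.

(* The action of h(n).  The three cases are n = 0, n = j + 1 > 0 (where h(n)  *)
(* is the derivation a_i(-n) |-> n (h | a_i) annihilating every e^g) and      *)
(* n = - (j + 1) < 0.                                                         *)
Definition heis h (n : int) : V -> V := linext (fun k : vkey r =>
  match n with
  | Posz 0 => lform L h (lemb C (mom k)) *: << k >>
  | Posz j.+1 => \sum_(i < r)
      (j.+1%:R * lform L h (hbasis i) * (osc k (i, j))%:R) *:
        << VKey (osc k `\ (i, j))%mset (mom k) >>
  | Negz j => \sum_(i < r) h 0 i *: << VKey ((i, j) +` osc k)%mset (mom k) >>
  end).

Definition current h : fseries V := fun p => heis h (- p - 1).

Definition eop a : V -> V := linext (fun k : vkey r =>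
  (eps a (mom k))%:~R *: << VKey (osc k) (a + mom k) >>).

Definition zop a : fseries V := fun p => linext (fun k : vkey r =>
  if p == lform L a (mom k) then << k >> else 0).

(* Y(e^a, z).  In both exponents the coefficient of z^p is a(-p)/p: for       *)
(* p = - n < 0 this is - a(n)/n.                                              *)
Definition Yexp a : fseries V :=
  let X (P : pred int) : fseries V := fun p v =>
    if P p then (p%:~R)^-1 *: heis (lemb C a) (- p) v else 0 in
  fmul (fexp (X (fun p => 0 < p)))
    (fmul (fexp (X (fun p => p < 0))) (fun p v => eop a (zop a p v))).

(* The creation parts commute with each other, and so do the annihilation     *)
(* parts, so the order in which the multiset is enumerated is irrelevant.     *)
Definition Ykey (k : vkey r) : fseries V :=
  foldr (fun x => nord (fdivderiv x.2 (current (hbasis x.1))))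
    (Yexp (mom k)) (enum_mset (osc k)).

Definition Y v : fseries V := fun p w => linext (fun k => Ykey k p w) v.

(* a_n b, where Y(a, z) = \sum_n a_n z^(-n-1) *)
Definition vmode v (n : int) w : V := Y v (- n - 1) w.

(* r orthonormal vectors in C^r are linearly independent, hence a basis.      *)
Definition orthonormal_basis (u : 'I_r -> 'rV[C]_r) :=
  forall i j, lform L (u i) (u j) = (i == j)%:R.

Definition virasoro (u : 'I_r -> 'rV[C]_r) : V :=
  2^-1 *: \sum_(i < r) heis (u i) (-1) (heis (u i) (-1) vac).

Definition kweight (k : vkey r) : rat :=
  (\sum_(x <- enum_mset (osc k)) x.2.+1)%:R + (lform L (mom k) (mom k))%:~R / 2.

Definition wtspace (n : nat) : set V :=
  [set v | forall k, k \in msupp v -> kweight k = n%:R].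

Definition sectors (M : set 'rV[int]_r) : set V :=
  [set v | forall k, k \in msupp v -> M (mom k)].

End LatticeVOA.

Definition lspan (C : fieldType) (V : lmodType C) (S : set V) : set V :=
  [set v | exists s : seq (C * V),
     (forall p, p \in s -> S p.2) /\ v = \sum_(p <- s) p.1 *: p.2].

(* The data of a (sub)VOA which enter the definition of C_1(V); the           *)
(* underlying vector space is the subspace vcarrier of an ambient space on    *)
(* which the modes act.                                                       *)
Record vertexData (C : fieldType) := VertexData {
  vambient : lmodType C;
  vcarrier : set vambient;
  vprod : vambient -> int -> vambient -> vambient;
  vconf : vambient;
  vhomog : nat -> set vambient
}.

Section C1.
Variables (C : fieldType) (V : vertexData C).

Definition vplus : set (vambient V) :=
  lspan [set v | vcarrier v /\ exists2 n : nat, (0 < n)%N & vhomog n v].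

(* Y(omega, z) = \sum_n L(n) z^(-n-2), that is, L(n) = omega_(n+1) *)
Definition Lvir (n : int) (v : vambient V) := vprod (vconf V) (n + 1) v.

Definition C1 : set (vambient V) :=
  lspan ([set x | exists a b, [/\ vplus a, vplus b & x = vprod a (-1) b]] `|`
         [set x | exists2 v, vplus v & x = Lvir (-1) v]).

Definition C1_cofinite :=
  exists s : seq (vambient V),
    (forall x, x \in s -> vcarrier x) /\
    forall v, vcarrier v ->
      exists2 w, lspan [set x | x \in s] w & C1 (v - w).

End C1.

Definition lattice_subVOA (C : fieldType) r (L : evenLattice r)
    (eps : 'rV[int]_r -> 'rV[int]_r -> int) (u : 'I_r -> 'rV[C]_r)
    (M : set 'rV[int]_r) : vertexData C :=
  {| vambient := (lvect C r : lmodType C);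
     vcarrier := sectors M;
     vprod := vmode L eps;
     vconf := virasoro L u;
     vhomog := wtspace L |}.

Definition A2_gram : 'M[int]_2 := \matrix_(i, j) (if i == j then 2 else -1).

Lemma A2_formE (x y : 'rV[int]_2) :
  gform A2_gram x y =
  2 * (x 0 0 * y 0 0 + x 0 1 * y 0 1) - x 0 0 * y 0 1 - x 0 1 * y 0 0.
Proof.
rewrite /gform !mxE !big_ord_recl big_ord0 !mxE !big_ord_recl !big_ord0 !mxE /=.
by rewrite (_ : lift _ _ = 1) ?intz; [ring | apply: val_inj].
Qed.

Lemma A2_sym : A2_gram^T = A2_gram.
Proof. by apply/matrixP => i j; rewrite !mxE eq_sym. Qed.

Lemma A2_pos (v : 'rV[int]_2) : v != 0 -> 0 < gform A2_gram v v.
Proof.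
rewrite A2_formE => v0; have : (v 0 0 != 0) || (v 0 1 != 0).
  apply: contraNT v0; rewrite negb_or !negbK => /andP[/eqP v0 /eqP v1].
  apply/eqP/rowP => i; rewrite mxE.
  by case: (unliftP 0 i) => [j ->|->] //; rewrite ord1 (_ : lift _ _ = 1) //;
    apply: val_inj.
move: (v 0 0) (v 0 1) => x y xy0.
rewrite (_ : _ - _ - _ = x ^+ 2 + y ^+ 2 + (x - y) ^+ 2); last by ring.
rewrite ltr_pwDl ?sqr_ge0 // lt0r addr_ge0 ?sqr_ge0 // andbT.
by rewrite paddr_eq0 ?sqr_ge0 // !sqrf_eq0 negb_and.
Qed.

Lemma A2_even (v : 'rV[int]_2) : (2 %| gform A2_gram v v)%Z.
Proof.
rewrite A2_formE; apply/dvdzP.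
exists (v 0 0 * v 0 0 + v 0 1 * v 0 1 - v 0 0 * v 0 1); ring.
Qed.

Definition A2 := EvenLattice A2_sym A2_pos A2_even.

Definition A2_alpha : 'rV[int]_2 := delta_mx 0 0.
Definition A2_beta : 'rV[int]_2 := delta_mx 0 1.

Definition A2_P : set 'rV[int]_2 :=
  [set v | exists (m : int) (n : nat), v = m *: A2_alpha + n%:Z *: A2_beta].

Section Linext.
Variables (C : fieldType) (K : choiceType) (W : lmodType C).
Implicit Types (f : K -> W).

Lemma linextEw f (D : {fset K}) (v : {malg C[K]}) :
  (msupp v `<=` D)%fset -> linext f v = \sum_(k <- D) v@_k *: f k.
Proof.
move=> vD; rewrite linext.unlock (big_fset_incl _ vD) // => k _ /mcoeff_outdom ->.
by rewrite scale0r.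
Qed.

Lemma linext_is_linear f : linear (linext f).
Proof.
move=> a u v; pose D := (msupp (a *: u + v) `|` (msupp u `|` msupp v))%fset.
rewrite !(@linextEw _ D); last 3 first.
- by apply/fsubsetP => x; rewrite !inE => ->; rewrite !orbT.
- by apply/fsubsetP => x; rewrite !inE => ->; rewrite !orbT.
- by apply/fsubsetP => x; rewrite !inE => ->.
rewrite scaler_sumr -big_split /=; apply: eq_bigr => k _.
by rewrite mcoeffD mcoeffZ scalerDl scalerA.
Qed.
HB.instance Definition _ f :=
  GRing.isLinear.Build C {malg C[K]} W *:%R (linext f) (linext_is_linear f).

Lemma linextU f k : linext f << k >> = f k.
Proof.
rewrite (@linextEw _ [fset k]%fset) ?msuppU_le //.
by rewrite big_seq_fset1 mcoeffUU scale1r.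
Qed.

Lemma malg_lin_eq (f g : {linear {malg C[K]} -> W}) :
  (forall k, f << k >> = g << k >>) -> f =1 g.
Proof.
move=> fg v; rewrite [v](monalgEw (fsubset_refl _)) !linear_sum.
apply: eq_bigr => k _; rewrite -[v@_k]mulr1.
have -> : << v@_k * 1 *g k >> = v@_k *: (<< k >> : {malg C[K]}).
  by apply/malgP => k'; rewrite mcoeffZ !mcoeffU mulrnAr.
by rewrite !linearZ fg.
Qed.
End Linext.

Lemma vkeyE r (k : vkey r) : k = VKey (osc k) (mom k). Proof. by case: k. Qed.

Section Heis.
Variables (C : fieldType) (r : nat) (L : evenLattice r).
Local Notation V := (lvect C r).
Implicit Types (h : 'rV[C]_r) (a : 'rV[int]_r) (v w : V).

Lemma gformDl (K : comPzRingType) (G : 'M[int]_r) (c : K) (x y z : 'rV[K]_r) :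
  gform G (c *: x + y) z = c * gform G x z + gform G y z.
Proof. by rewrite /gform !mulmxDl -!scalemxAl !mxE. Qed.

Lemma lformC (K : comPzRingType) (x y : 'rV[K]_r) : lform L x y = lform L y x.
Proof.
have trE (A : 'M[K]_1) : A 0 0 = A^T 0 0 by rewrite mxE.
rewrite /lform /gform trE !trmx_mul trmxK mulmxA.
by rewrite matrix.map_trmx gram_sym.
Qed.

Lemma lform_sum (K : comPzRingType) (x y : 'rV[K]_r) :
  lform L x y = \sum_i y 0 i * lform L x (delta_mx 0 i).
Proof.
rewrite {1}/lform /gform mxE; apply: eq_bigr => i _.
rewrite [y^T _ _]mxE mulrC; congr (_ * _).
by rewrite /lform /gform trmx_delta -colE [RHS]mxE.
Qed.

HB.instance Definition _ h n := GRing.isLinear.Build C V V *:%R (heis L h n)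
  (@linext_is_linear C _ _ _).

Definition hcre (x : 'I_r * nat) : V -> V :=
  linext (fun k : vkey r => << VKey (x +` osc k)%mset (mom k) >>).
Definition hann (x : 'I_r * nat) : V -> V :=
  linext (fun k : vkey r => ((osc k) x)%:R *: << VKey (osc k `\ x)%mset (mom k) >>).
HB.instance Definition _ x := GRing.isLinear.Build C V V *:%R (hcre x)
  (@linext_is_linear C _ _ _).
HB.instance Definition _ x := GRing.isLinear.Build C V V *:%R (hann x)
  (@linext_is_linear C _ _ _).

Lemma hcreU x k : hcre x << k >> = << VKey (x +` osc k)%mset (mom k) >>.
Proof. exact: linextU. Qed.
Lemma hannU x k : hann x << k >> = ((osc k) x)%:R *: << VKey (osc k `\ x)%mset (mom k) >>.
Proof. exact: linextU. Qed.

Lemma heisN h j v : heis L h (Negz j) v = \sum_i h 0 i *: hcre (i, j) v.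
Proof.
rewrite /heis /hcre linext.unlock; under [RHS]eq_bigr do rewrite scaler_sumr.
rewrite exchange_big; apply: eq_bigr => k _ /=; rewrite scaler_sumr.
by apply: eq_bigr => i _; rewrite !scalerA mulrC.
Qed.

Lemma heisP h j v : heis L h (Posz j.+1) v =
  \sum_i (j.+1%:R * lform L h (hbasis C i)) *: hann (i, j) v.
Proof.
rewrite /heis /hann linext.unlock; under [RHS]eq_bigr do rewrite scaler_sumr.
rewrite exchange_big; apply: eq_bigr => k _ /=; rewrite scaler_sumr.
apply: eq_bigr => i _; move: (lform _ _ _) v@_k ((osc k) _) << _ >> => c d n w.
by rewrite !scalerA; congr (_ *: _); ring.
Qed.

Lemma heis0U h k : heis L h 0 << k >> = lform L h (lemb C (mom k)) *: << k >>.
Proof. by rewrite /heis linextU. Qed.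

Lemma hcreC x y v : hcre x (hcre y v) = hcre y (hcre x v).
Proof.
apply: (@malg_lin_eq C _ _ (hcre x \o hcre y) (hcre y \o hcre x)) => k /=.
by rewrite !hcreU /= msetDCA.
Qed.

Lemma hannC x y v : hann x (hann y v) = hann y (hann x v).
Proof.
apply: (@malg_lin_eq C _ _ (hann x \o hann y) (hann y \o hann x)) => k /=.
rewrite !hannU /= !linearZ /= !hannU /= !scalerA -!natrM !msetB1E.
have -> : (osc k `\ y `\ x = osc k `\ x `\ y)%mset.
  by apply/msetP => z; rewrite !msetB1E -!subnDA addnC.
have [->//|xy] := eqVneq x y.
by rewrite ?(negbTE xy) !subn0 mulnC.
Qed.

Lemma hann_hcre x y v : hann x (hcre y v) = hcre y (hann x v) + (x == y)%:R *: v.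
Proof.
pose f := (x == y)%:R \*: (idfun : V -> V).
apply: (@malg_lin_eq C _ _ (hann x \o hcre y) ((hcre y \o hann x) \+ f)) => -[m a] /=.
rewrite hcreU !hannU /= linearZ /= hcreU /= mset1DE /f /=.
have [->|xy] := eqVneq x y.
  rewrite msetD1K -[(m y)%:R *: _]/((m y)%:R *: _).
  have -> : (m y)%:R *: (<< VKey (y +` (m `\ y))%mset a >> : V) =
            (m y)%:R *: << VKey m a >>.
    have [k0|k0] := eqVneq (m y) 0%N; first by rewrite k0 !scale0r.
    by rewrite msetB1K -?mset_neq0.
  by rewrite -scalerDl -natrD addnC.
have -> : ((y +` m) `\ x = y +` (m `\ x))%mset.
  apply/msetP => z; rewrite !(msetB1E, mset1DE).
  by case: (eqVneq z x) => [->|_]; rewrite ?(negbTE xy) ?subn0.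
by rewrite scale0r addr0 add0n.
Qed.

Lemma heis_hcre h m x v : heis L h m (hcre x v) = hcre x (heis L h m v) +
  (m%:~R * (m == Posz x.2.+1)%:R * lform L h (hbasis C x.1)) *: v.
Proof.
case: m => [[|j]|j].
- rewrite mul0r mul0r scale0r addr0.
  apply: (@malg_lin_eq C _ _ (heis L h 0 \o hcre x) (hcre x \o heis L h 0)) => k /=.
  by rewrite hcreU !heis0U /= linearZ /= hcreU.
- rewrite !heisP linear_sum /=.
  under eq_bigr do rewrite hann_hcre scalerDr.
  rewrite big_split /=; congr (_ + _).
    by apply: eq_bigr => i _; rewrite linearZ.
  rewrite (bigD1 x.1) //= [X in _ + X]big1 => [|i ix]; last first.
    by rewrite (_ : (i, j) == x = false) ?scale0r ?scaler0 //; apply: contraNF ix => /eqP <-.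
  have -> : ((x.1, j) == x) = (Posz j.+1 == Posz x.2.+1).
    by case: x => i n /=; rewrite xpair_eqE eqxx.
  by rewrite addr0 scalerA mulrAC pmulrn.
- rewrite !heisN mulr0 mul0r scale0r addr0 linear_sum; apply: eq_bigr => i _.
  by rewrite linearZ /= hcreC.
Qed.

Lemma heis_comm_ann h1 h2 m n v : 0 <= m -> 0 <= n ->
  heis L h1 m (heis L h2 n v) = heis L h2 n (heis L h1 m v).
Proof.
have E0P h h' j w : heis L h 0 (heis L h' (Posz j.+1) w) = heis L h' (Posz j.+1) (heis L h 0 w).
  apply: (@malg_lin_eq C _ _ (heis L h 0 \o heis L h' (Posz j.+1)) (heis L h' (Posz j.+1) \o heis L h 0)) => k /=.
  rewrite heis0U linearZ /= !heisP linear_sum scaler_sumr; apply: eq_bigr => i _ /=.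
  rewrite linearZ /= hannU linearZ /= heis0U /= !scalerA; congr (_ *: _); ring.
case: m => [[|m]|m]; last by [].
  move=> _; case: n => [[|n]|n]; last by [].
    move=> _; move: v.
    apply: (@malg_lin_eq C _ _ (heis L h1 0 \o heis L h2 0) (heis L h2 0 \o heis L h1 0)) => k /=.
    by rewrite !heis0U !linearZ /= !heis0U !scalerA mulrC.
  by move=> _; exact: E0P.
move=> _; case: n => [[|n]|n]; last by [].
  move=> _. exact: (esym (E0P h2 h1 m v)).

move=> _.
rewrite heisP [heis L h1 _ v]heisP linear_sum; apply: eq_bigr => i _.
rewrite linearZ /= !heisP linear_sum; congr (_ *: _).
by apply: eq_bigr => k _; rewrite linearZ /= hannC.
Qed.

Lemma seq_mset_cons (T : choiceType) (x : T) s :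
  seq_mset (x :: s) = (x +` seq_mset s)%mset.
Proof. by apply/msetP => z; rewrite mset1DE !mset_seqE /= eq_sym. Qed.

Lemma heis_ind (P : V -> Prop) :
  P 0 -> (forall c u v, P u -> P v -> P (c *: u + v)) ->
  (forall a, P (vexp C a)) -> (forall x v, P v -> P (hcre x v)) ->
  forall v, P v.
Proof.
move=> P0 PD Pe Pcre v; rewrite [v](monalgEw (fsubset_refl _)).
elim: (enum_fset _) => [|k s IHs]; first by rewrite big_nil.
rewrite big_cons; have -> : << v@_k *g k >> = v@_k *: (<< k >> : V).
  by apply/malgP => k'; rewrite mcoeffZ !mcoeffU mulrnAr mulr1.
apply: PD IHs; case: k => m a; rewrite -[m]seq_mset_id.
elim: (enum_mset m) => [|x s' IHs'].
  rewrite (_ : seq_mset [::] = mset0); first exact: Pe.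
  by apply/msetP => z; rewrite mset_seqE mset0E.
by have := Pcre x _ IHs'; rewrite hcreU seq_mset_cons.
Qed.

Lemma lformDl h1 h2 h c :
  lform L (c *: h1 + h2) h = c * lform L h1 h + lform L h2 h.
Proof. exact: gformDl. Qed.

Lemma heis_linear c h1 h2 n v :
  heis L (c *: h1 + h2) n v = c *: heis L h1 n v + heis L h2 n v.
Proof.
case: n => [[|j]|j].
- move: v; apply: (@malg_lin_eq C _ _ (heis L (c *: h1 + h2) 0)
    ((c \*: heis L h1 0) \+ heis L h2 0)) => k /=.
  by rewrite !heis0U lformDl scalerDl scalerA.
- rewrite !heisP scaler_sumr -big_split /=; apply: eq_bigr => i _.
  by rewrite lformDl scalerA -scalerDl; congr (_ *: _); ring.
- rewrite !heisN scaler_sumr -big_split /=; apply: eq_bigr => i _.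
  by rewrite !mxE scalerDl scalerA.
Qed.

Lemma heis_comm h1 h2 m n v :
  heis L h1 m (heis L h2 n v) - heis L h2 n (heis L h1 m v) =
  (m%:~R * (m + n == 0)%:R * lform L h1 h2) *: v.
Proof.
wlog mn : h1 h2 m n / 0 <= m \/ n < 0.
  move=> H; have [m0|m0] := leP 0 m; first by apply: H; left.
  have [n0|n0] := leP 0 n; last by apply: H; right.
  apply: oppr_inj; rewrite opprB H; last by left.
  rewrite -scaleNr lformC addrC; congr (_ *: _); rewrite -!mulNr; congr (_ * _).
  have [/eqP|_] := eqVneq (m + n) 0; last by rewrite !mulr0.
  by rewrite addr_eq0 => /eqP ->; rewrite !mulr1 mulrNz opprK.
have annann : 0 <= m -> 0 <= n -> (m%:~R * (m + n == 0)%:R = 0 :> C).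
  case: m {mn} => [m|//]; case: n => [n|//] _ _.
  by case: m => [|m]; rewrite ?mul0r ?mulr0.
have [n0|] := leP 0 n.
  case: mn => [m0|]; last by rewrite ltNge n0.
  by rewrite heis_comm_ann // subrr annann // mul0r scale0r.
case: n {mn annann} => [//|j] _.
rewrite !heisN linear_sum /= -sumrB.
rewrite (eq_bigr (fun i => (h2 0 i * (m%:~R * (m == Posz j.+1)%:R * lform L h1 (hbasis C i))) *: v)).
  rewrite -scaler_suml; congr (_ *: _).
  rewrite [in RHS](lform_sum h1 h2) mulr_sumr; apply: eq_bigr => i _.
  by rewrite NegzE subr_eq0 mulrCA.
by move=> i _; rewrite linearZ /= -scalerBr heis_hcre addrC addKr scalerA.
Qed.

Lemma heis_vexp0 h a : heis L h 0 (vexp C a) = lform L h (lemb C a) *: vexp C a.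
Proof. exact: heis0U. Qed.

Lemma heis_vexp_gt0 h n a : 0 < n -> heis L h n (vexp C a) = 0.
Proof.
case: n => [[|j]|] // _; rewrite heisP big1 // => i _.
by rewrite hannU /= mset0E scale0r scaler0.
Qed.

Lemma hcreE i j v : hcre (i, j) v = heis L (hbasis C i) (Negz j) v.
Proof.
rewrite heisN (bigD1 i) //= big1 => [|k ki]; rewrite mxE !eqxx ?scale1r ?addr0 //.
by rewrite (negbTE ki) scale0r.
Qed.

(* M(1, a) is the module induced from C e^a: for any representation of the    *)
(* Heisenberg algebra on W with K = 1 and any vectors e a on which h(n),      *)
(* n >= 0, acts as on e^a, there is a unique morphism V_L -> W mapping every  *)
(* e^a to e a.                                                                *)
Section Induced.
Variables (W : lmodType C) (rho : 'rV[C]_r -> int -> {linear W -> W}).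
Variable (e : 'rV[int]_r -> W).
Hypothesis rho_lin : forall c h1 h2 n x,
  rho (c *: h1 + h2) n x = c *: rho h1 n x + rho h2 n x.
Hypothesis rho_comm : forall h1 h2 m n x,
  rho h1 m (rho h2 n x) - rho h2 n (rho h1 m x) =
  (m%:~R * (m + n == 0)%:R * lform L h1 h2) *: x.
Hypothesis rho0 : forall h a, rho h 0 (e a) = lform L h (lemb C a) *: e a.
Hypothesis rho_gt0 : forall h n a, 0 < n -> rho h n (e a) = 0.

Let R (x : 'I_r * nat) := rho (hbasis C x.1) (Negz x.2).

Let R_comm x y (w : W) : R x (R y w) = R y (R x w).
Proof.
apply/eqP; rewrite -subr_eq0 rho_comm.
by rewrite (_ : _ + _ == 0 = false) ?mulr0 ?mul0r ?scale0r.
Qed.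

Let F s (w : W) := foldr (fun x => R x) w s.

Let F_perm s1 s2 (w : W) : perm_eq s1 s2 -> F s1 w = F s2 w.
Proof.
have RF x s (w' : W) : R x (F s w') = F s (R x w').
  by elim: s => //= y s IHs; rewrite R_comm IHs.
have FF s s' (w' : W) : F s (F s' w') = F s' (F s w').
  by elim: s => //= y s IHs; rewrite IHs RF.
move=> p12; apply: (@catCA_perm_ind _ (fun s => F s1 w = F s w)) p12 _ => //.
move=> t1 t2 t3 ->; rewrite /F !foldr_cat; exact: FF.
Qed.

Let f : V -> W := linext (fun k => F (osc k) (e (mom k))).
HB.instance Definition _ := GRing.isLinear.Build C V W *:%R f
  (@linext_is_linear C _ _ _).

Let f_hcre x v : f (hcre x v) = R x (f v).
Proof.
move: v; apply: (@malg_lin_eq C _ W (f \o hcre x) (R x \o f)) => k /=.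
have p : perm_eq (x +` osc k)%mset (x :: osc k).
  by have := perm_eq_seq_mset (x :: osc k); rewrite seq_mset_cons seq_mset_id.
by rewrite hcreU /f !linextU /= (F_perm _ p).
Qed.

Let f_vexp a : f (vexp C a) = e a.
Proof. by rewrite /f linextU /= enum_mset0. Qed.

Let rho_sum h n (x : W) : rho h n x = \sum_i h 0 i *: rho (hbasis C i) n x.
Proof.
have rho0' : rho 0 n x = 0.
  by have := rho_lin 1 0 0 n x; rewrite !scale1r addr0 => /(canLR (addrK _)) <-; rewrite subrr.
rewrite {1}[h]row_sum_delta; elim/big_rec2: _ => // i y z _ IH.
by rewrite rho_lin IH.
Qed.

Let f_heis h n v : f (heis L h n v) = rho h n (f v).
Proof.
have [n0|] := leP 0 n; last first.
  case: n => // j _; rewrite heisN linear_sum rho_sum; apply: eq_bigr => i _.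
  by rewrite linearZ /= f_hcre.
move: v; apply: heis_ind => [|c u v IHu IHv|a|x v IH].
- by rewrite !linear0.
- by rewrite !linearP /= IHu IHv.
- rewrite f_vexp; case: (ltrgtP 0 n) n0 => // [n0|<-] _.
    by rewrite heis_vexp_gt0 // rho_gt0 // linear0.
  by rewrite heis_vexp0 linearZ /= rho0 f_vexp.
case: x => i j; rewrite f_hcre hcreE.
have := heis_comm h (hbasis C i) n (Negz j) v; move/(canRL (subrK _)) => ->.
have := rho_comm h (hbasis C i) n (Negz j) (f v); move/(canRL (subrK _)) => ->.
by rewrite linearD /= linearZ -!hcreE /= f_hcre IH.
Qed.

Lemma heis_induced : exists g : {linear V -> W},
  [/\ forall a, g (vexp C a) = e a,
      forall h n v, g (heis L h n v) = rho h n (g v)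
    & forall g' : {linear V -> W}, (forall a, g' (vexp C a) = e a) ->
        (forall h n v, g' (heis L h n v) = rho h n (g' v)) -> g' =1 g].
Proof.
exists f; split => // g ge gh; apply: heis_ind => [|c u v IHu IHv|a|x v IH].
- by rewrite !linear0.
- by rewrite !linearP /= IHu IHv.
- by rewrite ge; apply: esym; exact: f_vexp.
- case: x => i j; rewrite hcreE gh IH; apply: esym; exact: f_heis.
Qed.

End Induced.

Section VertexOperators.
Variable eps : 'rV[int]_r -> 'rV[int]_r -> int.
Hypothesis eps_cocycle : is_cocycle L eps.

Lemma fsum1 (I : choiceType) (F : I -> V) j :
  (forall i, i != j -> F i = 0) -> \sum_(i \in [set: I]) F i = F j.
Proof.
move=> F0; rewrite (fsbigTE [fset j]%fset) ?big_seq_fset1 // => i.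
by rewrite inE; exact: F0.
Qed.

Lemma fmul1 (B : fseries V) p v : fmul (@fone C V) B p v = B p v.
Proof.
rewrite /fmul (@fsum1 _ _ 0) /fone ?eqxx ?subr0 // => i i0.
by rewrite (negbTE i0).
Qed.

Lemma fexp1 (A : fseries V) p v : (forall j, A j 0 = 0) -> (forall j, A j v = 0) ->
  fexp A p v = fone p v.
Proof.
move=> A0 Av; rewrite /fexp (@fsum1 _ _ 0%N) /= ?fact0 ?invr1 ?scale1r //.
suff H j q : iter j.+1 (fmul A) (@fone _ _) q v = 0.
  by case=> // j _; rewrite H scaler0.
elim: j q => [|j IH] q; rewrite iterS /fmul.
  by rewrite fsbig1 // => q' _ /=; rewrite /fone; case: eqP.
by rewrite fsbig1 // => q' _; rewrite -/(fmul A) IH.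
Qed.

Lemma fexp_pos0 (A : fseries V) v : (forall q w, q <= 0 -> A q w = 0) ->
   (forall j, A j 0 = 0) -> fexp A 0 v = v.
Proof.
move=> A0 Av; rewrite /fexp (@fsum1 _ _ 0%N) /= ?fact0 ?invr1 ?scale1r //.
suff H j q : q < Posz j -> iter j (fmul A) (@fone _ _) q v = 0.
  by move=> j j0; rewrite H ?scaler0 // ltz_nat lt0n.
elim: j q => [|j IH] q qj /=; first by rewrite /fone; case: eqP qj => // ->.
rewrite /fmul fsbig1 // => q' _; have [q'0|q'0] := leP q' 0; first exact: A0.
by rewrite -/(fmul A) IH //; lia.
Qed.

Lemma Yexp_lead a b :
  @Yexp C r L eps a (lform L a b) (vexp C b) = (eps a b)%:~R *: vexp C (a + b).
Proof.
rewrite /Yexp; set A := (X in fmul (fexp X)); set B := (X in fmul _ (fmul (fexp X) _)).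
set Z := fun p v => _.
have ZE p : Z p (vexp C b) = if p == lform L a b then (eps a b)%:~R *: vexp C (a + b) else 0.
  rewrite /Z /zop linextU /=; case: ifP => _; last by rewrite /eop linear0.
  by rewrite /eop linextU.
have BZ p : fmul (fexp B) Z p (vexp C b) = Z p (vexp C b).
  rewrite -[RHS](fmul1 Z) /fmul; apply: eq_fsbigr => q _; rewrite fexp1 //.
    by move=> j; rewrite /B; case: ifP => _ //; rewrite linear0 scaler0.
  move=> j; rewrite /B; case: ifP => // j0; rewrite ZE; case: ifP => _; rewrite ?linear0 ?scaler0 //.
  by rewrite linearZ /= heis_vexp_gt0 ?scaler0 // oppr_gt0.
rewrite {1}/fmul (@fsum1 _ _ 0).
  rewrite subr0 BZ ZE eqxx fexp_pos0 // => [q w q0|j]; rewrite /A.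
    by rewrite ltNge q0.
  by case: ifP => _ //; rewrite linear0 scaler0.
move=> q q0; rewrite BZ ZE ifF; last first.
  by apply: contraNF q0 => /eqP; lia.
rewrite fexp1 ?/fone ?if_same // => j; rewrite /A; case: ifP => _ //; by rewrite linear0 scaler0.
Qed.

Lemma heis0l n v : heis L 0 n v = 0.
Proof.
have := heis_linear 1 0 0 n v.
by rewrite !scale1r addr0 => /(canLR (addrK _)) <-; rewrite subrr.
Qed.

Lemma Y_vac p v : @Yexp C r L eps 0 p v = fone p v.
Proof.
have H (P : pred int) q w: fexp (fun p (v : V) => if P p then (p%:~R)^-1 *: heis L (lemb C 0) (- p) v else 0) q w = fone q w.
  have e : lemb C (0 : 'rV[int]_r) = 0 by rewrite /lemb map_mx0.
  by apply: fexp1 => j; case: ifP; rewrite // e heis0l scaler0.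
have H' P : fexp _ = @fone C V := funext (fun q => funext (H P q)).
rewrite /Yexp !H' !fmul1.
rewrite /zop /fone; case: eps_cocycle => _ _ _ e0.
have [->|p0] := eqVneq p 0; move: v.
  apply: (@malg_lin_eq C _ _ (linext _ \o linext _) idfun) => -[m b] /=.
  rewrite linextU /= /lform /gform !mul0mx mxE eqxx linextU /= (e0 b).1.
  by rewrite scale1r add0r.
apply: (@malg_lin_eq C _ _ (linext _ \o linext _) (\0 : {linear V -> V})) => -[m b] /=.
by rewrite linextU /= /lform /gform !mul0mx mxE (negbTE p0) linear0.
Qed.

Lemma Y_current h n v : vmode L eps (heis L h (-1) (vac C r)) n v = heis L h n v.
Proof.
rewrite (heisN h 0).
rewrite /vmode /Y linear_sum /=.
transitivity (\sum_i h 0 i *: heis L (hbasis C i) n v); last first.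
  have rho0' : heis L 0 n v = 0 by exact: heis0l.
  rewrite {2}[h]row_sum_delta; elim/big_rec2: _ => // i y z _ IH.
  by rewrite heis_linear IH.
apply: eq_bigr => i _; rewrite linearZ /=; congr (_ *: _).
rewrite hcreU linextU /Ykey /= msetD0 enum_msetn /=.
rewrite /nord /fdivderiv /= fact0 invr1.
rewrite /fmul (@fsum1 _ _ (- n - 1)) => [|q qn]; last first.
  by rewrite Y_vac /fone subr_eq0 eq_sym (negbTE qn); case: ifP => _ //; rewrite /current linear0 scaler0.
rewrite (@fsum1 _ _ 0) => [|q qn]; last by rewrite Y_vac /fone (negbTE qn).
rewrite !Y_vac /fone subrr subr0 !eqxx /current !scale1r.
rewrite (_ : - (- n - 1) - 1 = n); last by ring.
by have [H|H] := ltP; rewrite ?addr0 ?add0r.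
Qed.

End VertexOperators.
End Heis.

(* Main.v *)
Require Import Defs.
From mathcomp Require Import all_boot all_order all_algebra.
From mathcomp Require Import complex reals.
From mathcomp Require Import finmap multiset boolp classical_sets fsbigop.
From mathcomp Require Import zify.
From mathcomp.multinomials Require Import monalg.

(** Parabolicity is a computation with coordinates: the vectors n beta + m alpha
with n > 0, or n = 0 and m >= 0, form a Borel-type submonoid of P, which lies in
the half-space of alpha + 2 beta.

For cofiniteness, let M be a submonoid of any even lattice L.  The PBW basis of
V_M is cut down modulo C_1 in three ways.

- A basis vector h(-n-1) b with b in V_+ lies in C_1, because it is the product
  a_{-1} b for a = h(-n-1) 1 ([C1_creation]).  What is left are the vectors
  h(-n-1) 1 and e^g.
- Since L(-1) h(-n) 1 = n h(-n-1) 1 ([virasoro_creation]), among the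
  h(-n-1) 1 only the finitely many with n = 0 matter ([C1_derivative]).
- If g = a + b with a, b nonzero in M and (a|b) >= 0, then e^g lies in C_1
  ([C1_vexpD]).  When (a|b) = 0 the leading term of Y(e^a, z) e^b gives
  (e^a)_{-1} e^b = eps(a, b) e^g.  When (a|b) = k + 1 > 0 that leading term sits
  at z^(k+1), so up to sign e^g is (e^a)_{-k-2} e^b; it is brought to
  mode -1 by inserting a current, which contributes z^(-k-1) through its zero
  mode: (h(-k-1) e^a)_{-1} e^b = (-1)^k (h|b) eps(a, b) e^g
  ([vmode_hcre_vexp]), and h can be chosen with (h|b) nonzero.

Hence V_M is C_1-cofinite as soon as all but finitely many elements of M split
as a sum of two nonzero elements of M with nonnegative product
([C1_cofinite_indecomposables]).  In P the exceptions are 0, alpha, -alpha, beta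
and alpha + beta ([A2_P_split]). *)

Set Implicit Arguments.
Unset Strict Implicit.
Unset Printing Implicit Defensive.

Import Order.TTheory GRing.Theory Num.Theory.
Local Open Scope classical_set_scope.
Local Open Scope ring_scope.

(** * Linear spans *)

Section LinearSpan.
Variables (C : fieldType) (V : lmodType C).
Implicit Types (S : set V) (x y : V).

Lemma lspan_sub S x : S x -> lspan S x.
Proof.
move=> Sx; exists [:: (1, x)]; split=> [p|]; first by rewrite inE => /eqP ->.
by rewrite big_seq1 scale1r.
Qed.

Lemma lspan0 S : lspan S 0.
Proof. by exists [::]; rewrite big_nil. Qed.

Lemma lspanP S c x y : lspan S x -> lspan S y -> lspan S (c *: x + y).
Proof.
move=> [s [Ss ->]] [t [St ->]].
exists ([seq (c * p.1, p.2) | p <- s] ++ t); split=> [p|].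
  by rewrite mem_cat => /orP[/mapP[q qs ->]|]; [apply: (Ss q) | apply: St].
rewrite big_cat big_map scaler_sumr /=; congr (_ + _).
by apply: eq_bigr => p _; rewrite scalerA.
Qed.

Lemma lspanZ S c x : lspan S x -> lspan S (c *: x).
Proof. by move=> Sx; rewrite -[c *: x]addr0; exact: (lspanP c Sx (lspan0 S)). Qed.

Lemma lspan_scaleK S c x : c != 0 -> lspan S (c *: x) -> lspan S x.
Proof. by move=> c0 /(lspanZ c^-1); rewrite scalerA mulVf // scale1r. Qed.

End LinearSpan.

(** * Formal series and vertex operators on lattice vectors *)

Lemma perm2_mem (T : eqType) (x y : T) t :
  perm_eq t [:: x; y] -> t \in [:: [:: x; y]; [:: y; x]].
Proof.
case: t => [|a t] txy; first by have := perm_size txy.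
have := mem_head a t; rewrite (perm_mem txy) !inE => /orP[] /eqP ax.
  by move: txy; rewrite ax perm_cons => /perm_small_eq -> //; rewrite eqxx.
move: txy; rewrite ax (perm_sym (y :: t)) (perm_catC [:: x] [:: y]) /= perm_cons.
by rewrite perm_sym => /perm_small_eq -> //; rewrite eqxx orbT.
Qed.

(** The coefficient of z^(-k-1) under k-fold differentiation of z^(-1). *)
Lemma prod_fact k : \prod_(j < k) (- k.+1%:Z + j.+1%:Z) = (-1) ^+ k * k`!%:Z.
Proof.
elim: k => [|k IH]; first by rewrite big_ord0.
rewrite big_ord_recl exprS factS PoszM mulrACA -IH; congr (_ * _) => /=.
  by rewrite mulN1r; lia.
Qed.

Section Fields.
Variables (C : fieldType) (r : nat) (L : evenLattice r).
Local Notation V := (lvect C r).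
Implicit Types (h g : 'rV[C]_r) (a b : 'rV[int]_r) (v w : V) (A B : fseries V).

Lemma malg_sumE v : v = \sum_(k <- msupp v) v@_k *: (<< k >> : V).
Proof.
rewrite {1}[v](monalgEw (fsubset_refl _)); apply: eq_bigr => k _.
by apply/malgP => k'; rewrite mcoeffZ !mcoeffU mulrnAr mulr1.
Qed.

Lemma lform_lemb a b : lform L (lemb C a) (lemb C b) = (lform L a b)%:~R.
Proof.
rewrite /lform /gform /lemb.
have -> : map_mx intr (gram L) = gram L :> 'M[int]_r.
  by apply/matrixP => i j; rewrite mxE intz.
by rewrite matrix.map_trmx -!map_mxM mxE.
Qed.

Lemma fmul_fone A p v : (forall q, A q 0 = 0) -> fmul A (@fone C V) p v = A p v.
Proof.
move=> A0; rewrite /fmul (@fsum1 _ _ _ _ p) /fone ?subrr ?eqxx // => q qp.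
rewrite subr_eq0 eq_sym (negbTE qp); exact: A0.
Qed.

Lemma nord_fone A p v : (forall q, A q 0 = 0) -> nord A (@fone C V) p v = A p v.
Proof.
move=> A0; rewrite /nord fmul1 fmul_fone => [|q]; last by case: ifP.
by case: ltP; rewrite ?addr0 ?add0r.
Qed.

(** Every term of the j-th power of A carries at least z^j. *)
Lemma fexp_lt0 A p v : (forall q w, q <= 0 -> A q w = 0) ->
  (forall q, A q 0 = 0) -> p < 0 -> fexp A p v = 0.
Proof.
move=> A0 Av0 p0; rewrite /fexp fsbig1 // => j _.
suff -> : forall q, q < Posz j -> iter j (fmul A) (@fone _ _) q v = 0.
- by rewrite scaler0.
- by apply: lt_le_trans p0 _; rewrite lez_nat.
elim: j {p p0} => [|j IH] q qj /=; first by rewrite /fone; case: eqP qj => // ->.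
rewrite /fmul fsbig1 // => q' _; have [q'0|q'0] := leP q' 0; first exact: A0.
by rewrite -/(fmul A) IH ?Av0 //; lia.
Qed.

Lemma fdivderivE n A p v : fdivderiv n A p v =
  ((n`!%:R)^-1 * (\prod_(j < n) (p + j.+1%:Z))%:~R) *: A (p + n%:Z) v.
Proof.
rewrite /fdivderiv -scalerA; congr (_ *: _).
elim: n p => [|n IH] p /=; first by rewrite big_ord0 addr0 scale1r.
rewrite /fderiv IH scalerA -intrM big_ord_recl /= -addrA -intS.
congr (_%:~R *: _); congr (_ * _).
by apply: eq_bigr => j _; rewrite -addrA -intS.
Qed.

Lemma heis_sum h n v : heis L h n v = \sum_i h 0 i *: heis L (hbasis C i) n v.
Proof.
rewrite {1}[h]row_sum_delta; elim/big_rec2: _ => [|i x y _ IH].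
  exact: heis0l.
by rewrite heis_linear IH.
Qed.

Lemma heis_vac h n : 0 <= n -> heis L h n (vac C r) = 0.
Proof.
rewrite le_eqVlt => /orP[/eqP <-|n0]; last exact: heis_vexp_gt0.
by rewrite /vac heis_vexp0 lformC /lform /gform /lemb map_mx0 !mul0mx mxE scale0r.
Qed.

(** On h(-n) 1 the nonnegative modes act by contraction only: the zero mode sees
the momentum 0, and a positive mode kills the vacuum. *)
Lemma heis_creation h g (n : nat) (q : int) : 0 <= q ->
  heis L h q (heis L g (- n%:Z) (vac C r)) =
  (q%:~R * (q == n)%:R * lform L h g) *: vac C r.
Proof.
move=> q0; have := heis_comm L h g q (- n%:Z) (vac C r).
by rewrite (heis_vac h q0) linear0 subr0 subr_eq0.
Qed.

(** The mode 0 of :h(z) g(z):, that is, its coefficient of z^(-1), on a vector on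
which the only nonnegative mode acting nontrivially is N.  The answer is
symmetric in h and g, which makes the enumeration order of an oscillator
multiset harmless. *)
Lemma nord_currents h g (N : nat) v :
  (forall q : int, 0 <= q -> q != N -> heis L h q v = 0 /\ heis L g q v = 0) ->
  nord (current L h) (current L g) (-1) v =
  heis L h (- N.+1%:Z) (heis L g N v) + heis L g (- N.+1%:Z) (heis L h N v).
Proof.
move=> H0; rewrite /nord /fmul; congr (_ + _).
  rewrite (@fsum1 _ _ _ _ (N : int)) => [|q qN].
    by rewrite /current /=; congr (heis _ _ _ (heis _ _ _ _)); lia.
  case: ifP => // q0; rewrite /current.
  rewrite [X in heis _ g X](_ : _ = q); last by lia.
  by rewrite (H0 q q0 qN).2 linear0.
rewrite (@fsum1 _ _ _ _ (N : int)) => [|q qN].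
  rewrite /current ifT; last by lia.
  by congr (heis _ _ _ (heis _ _ _ _)); lia.
case: ifP => [q0|_]; rewrite /current ?linear0 //.
rewrite [X in heis _ h X](_ : _ = q); last by lia.
have q1 : 0 <= q by lia.
by rewrite (H0 q q1 qN).1 linear0.
Qed.

Variable eps : 'rV[int]_r -> 'rV[int]_r -> int.

(** The operator e_a z^a contributes z^(a|b) exactly, the annihilation exponential
fixes e^(a+b), and the creation exponential only raises the power of z: so
Y(e^a, z) e^b starts at z^(a|b).  The scalar c is carried along because
Y(e^a, z), an infinite sum of operators, is not linear by construction. *)
Lemma Yexp_vexp a b c p : p <= lform L a b ->
  Yexp L eps a p (c *: vexp C b) =
  if p == lform L a b then (c * (eps a b)%:~R) *: vexp C (a + b) else 0.
Proof.
move=> pab; rewrite /Yexp.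
set A := (X in fmul (fexp X)); set B := (X in fmul _ (fmul (fexp X) _)).
set Z := fun p v => _.
have ZE q : Z q (c *: vexp C b) =
    if q == lform L a b then (c * (eps a b)%:~R) *: vexp C (a + b) else 0.
  rewrite /Z /zop linearZ /= linextU /=; case: ifP => _.
    by rewrite /eop linearZ /= linextU scalerA.
  by rewrite scaler0 /eop linear0.
have B0 q : B q 0 = 0 by rewrite /B; case: ifP => // _; rewrite linear0 scaler0.
have BZ q : fmul (fexp B) Z q (c *: vexp C b) = Z q (c *: vexp C b).
  rewrite -[RHS](fmul1 Z) /fmul; apply: eq_fsbigr => q' _; rewrite fexp1 // => j.
  rewrite /B; case: ifP => // j0; rewrite -/B ZE.
  case: ifP => _; last by rewrite linear0 scaler0.
  by rewrite linearZ /= heis_vexp_gt0 ?scaler0 // oppr_gt0.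
have A0 (q : int) w : q <= 0 -> A q w = 0 by rewrite /A leNgt => /negbTE ->.
have Av0 q : A q 0 = 0 by rewrite /A; case: ifP => // _; rewrite linear0 scaler0.
rewrite {1}/fmul (@fsum1 _ _ _ _ (p - lform L a b)).
  rewrite BZ ZE subKr eqxx; case: eqP => [->|/eqP npab].
    by rewrite subrr fexp_pos0.
  by rewrite fexp_lt0 // subr_lt0 lt_neqAle npab.
move=> q qp; rewrite BZ ZE ifF; last by apply: contraNF qp => /eqP <-; rewrite subKr.
by rewrite fexp1 // /fone if_same.
Qed.

Lemma Yexp_0 a p : Yexp L eps a p (0 : V) = 0.
Proof.
have E0 (P : pred int) q : fexp (fun (p : int) (v : V) =>
    if P p then (p%:~R)^-1 *: heis L (lemb C a) (- p) v else 0) q 0 = 0.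
  have X0 j : (if P j then (j%:~R)^-1 *: heis L (lemb C a) (- j) 0 else 0) = 0 :> V.
    by case: ifP => // _; rewrite linear0 scaler0.
  by rewrite fexp1 // /fone if_same.
rewrite /Yexp /fmul fsbig1 // => q _; rewrite fsbig1 ?E0 // => q' _.
by rewrite /zop /eop !linear0 E0.
Qed.

End Fields.

(** * Products of generators *)

Section Products.
Variables (C : fieldType) (r : nat) (L : evenLattice r).
Variable eps : 'rV[int]_r -> 'rV[int]_r -> int.
Hypothesis char0 : [pchar C] =i pred0.
Hypothesis eps_cocycle : is_cocycle L eps.
Local Notation V := (lvect C r).
Local Notation vac := (vac C r).
Local Notation vexp := (vexp C).
Local Notation "a _( n ) b" := (vmode L eps a n b) (at level 39).
Implicit Types (h g : 'rV[C]_r) (a b : 'rV[int]_r) (v w : V) (A B : fseries V).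

Lemma natr_neq0 n : (n%:R != 0 :> C) = (n != 0)%N.
Proof. by rewrite ((pcharf0P C).1 char0). Qed.

Lemma Yexp0 : Yexp L eps 0 = @fone C V.
Proof. by apply/funext => p; apply/funext => v; rewrite Y_vac. Qed.

Lemma current0 h n p : fdivderiv n (current L h) p (0 : V) = 0.
Proof. by rewrite fdivderivE /current linear0 scaler0. Qed.

(** Normally ordered products are taken in the order in which the multiset happens
to be enumerated, so an explicit list of oscillators is only known up to
permutation. *)
Lemma Ykey_seq (s : seq ('I_r * nat)) a : exists2 t, perm_eq t s &
  Ykey L eps (VKey (seq_mset s) a) =
  foldr (fun x => nord (fdivderiv x.2 (current L (hbasis C x.1)))) (Yexp L eps a) t.
Proof. by exists (seq_mset s); rewrite ?perm_eq_seq_mset. Qed.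

Lemma vmode_hcre x a n w : (hcre x (vexp a)) _(n) w =
  nord (fdivderiv x.2 (current L (hbasis C x.1))) (Yexp L eps a) (- n - 1) w.
Proof.
rewrite /vmode /Y hcreU linextU /=.
have -> : (x +` mset0)%mset = seq_mset [:: x].
  by rewrite seq_mset_cons; congr (_ +` _)%mset; apply/msetP => z; rewrite mset_seqE mset0E.
by have [t /perm_small_eq -> // ->] := Ykey_seq [:: x] a.
Qed.

(** The constant term of the n-th divided derivative of h(z) is h(-n-1): the factor
1/n! cancels the product 1 * 2 * ... * n coming from differentiating z^n. *)
Lemma vmode_hcre_vac x w : (hcre x vac) _(-1) w = hcre x w.
Proof.
rewrite vmode_hcre Yexp0 opprK subrr nord_fone => [|q]; last exact: current0.
case: x => i n; rewrite fdivderivE /= add0r /current (hcreE L).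
have -> : - n%:Z - 1 = Negz n by lia.
have -> : \prod_(j < n) (0 + j.+1%:Z) = n`!%:Z.
  elim: n => [|n IH]; first by rewrite big_ord0.
  by rewrite big_ord_recr /= IH factS add0r mulrC -PoszM.
by rewrite mulVf ?scale1r // natr_neq0 -lt0n fact_gt0.
Qed.

Lemma vmode_hcre2 i j (N : nat) v :
  (forall h (q : int), 0 <= q -> q != N -> heis L h q v = 0) ->
  (hcre (i, 0%N) (hcre (j, 0%N) vac)) _(0) v =
  heis L (hbasis C i) (- N.+1%:Z) (heis L (hbasis C j) N v) +
  heis L (hbasis C j) (- N.+1%:Z) (heis L (hbasis C i) N v).
Proof.
move=> v0; rewrite /vmode /Y !hcreU linextU /=.
have -> : ((i, 0%N) +` ((j, 0%N) +` mset0))%mset = seq_mset [:: (i, 0%N); (j, 0%N)].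
  rewrite !seq_mset_cons; congr (_ +` (_ +` _))%mset.
  by apply/msetP => z; rewrite mset_seqE mset0E.
have D0 h : fdivderiv 0 (current L h) = current L h.
  apply/funext => p; apply/funext => w.
  by rewrite fdivderivE big_ord0 fact0 invr1 mul1r scale1r addr0.
have N1 h : nord (current L h) (@fone C V) = current L h.
  apply/funext => p; apply/funext => w; rewrite nord_fone // => q.
  by rewrite /current linear0.
have [t tij ->] := Ykey_seq [:: (i, 0%N); (j, 0%N)] 0.
have : t \in [:: [:: (i, 0%N); (j, 0%N)]; [:: (j, 0%N); (i, 0%N)]].
  exact: perm2_mem.
rewrite Yexp0 !inE => /orP[] /eqP -> /=; rewrite !D0 N1 (@nord_currents _ _ _ _ _ N) //.
- by move=> q q0 qN; rewrite !v0.
- exact: addrC.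
- by move=> q q0 qN; rewrite !v0.
Qed.

Lemma vmode_currents h g (N : nat) v :
  (forall h (q : int), 0 <= q -> q != N -> heis L h q v = 0) ->
  (heis L h (-1) (heis L g (-1) vac)) _(0) v =
  heis L h (- N.+1%:Z) (heis L g N v) + heis L g (- N.+1%:Z) (heis L h N v).
Proof.
move=> v0.
rewrite (heisN L h 0) (heisN L g 0) /vmode /Y linear_sum.
rewrite (heis_sum L h (- _)) (heis_sum L h N v) linear_sum -big_split /=.
apply: eq_bigr => i _; rewrite !linearZ /= -scalerDr; congr (_ *: _).
rewrite !linear_sum /= (heis_sum L g N v) (heis_sum L g (- _)) linear_sum -big_split.
apply: eq_bigr => j _; rewrite !linearZ /= -scalerDr; congr (_ *: _).
exact: vmode_hcre2.
Qed.

(** Orthonormality says that u has the right inverse G u^T, where G is the Gram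
matrix; a right inverse of a square matrix is a left inverse, which is the
expansion of h along the u i. *)
Lemma sum_orthonormal (u : 'I_r -> 'rV[C]_r) h : orthonormal_basis L u ->
  \sum_i lform L (u i) h *: u i = h.
Proof.
move=> uE; pose U := \matrix_i u i; pose G : 'M[C]_r := map_mx intr (gram L).
have UGU : U *m (G *m U^T) = 1%:M.
  apply/matrixP => i j; rewrite mulmxA [RHS]mxE -uE /lform /gform -/G.
  have UG k : (U *m G) i k = (u i *m G) 0 k.
    by rewrite -[u i](rowK u) -/U -row_mul [RHS]mxE.
  by rewrite [LHS]mxE [RHS]mxE; apply: eq_bigr => k _; rewrite UG !mxE.
rewrite -[RHS]mulmx1 -(mulmx1C UGU) !mulmxA mulmx_sum_row; apply: eq_bigr => i _.
rewrite rowK lformC /lform /gform -/G; congr (_ *: _).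
by rewrite [LHS]mxE [RHS]mxE; apply: eq_bigr => k _; rewrite !mxE.
Qed.

(** The mode 0 of the Virasoro element is L(-1), so this is the translation rule
L(-1) h(-n) 1 = n h(-n-1) 1.  Each term :u_i(z) u_i(z): contributes twice the
same contraction, which absorbs the factor 1/2. *)
Lemma virasoro_creation (u : 'I_r -> 'rV[C]_r) g (n : nat) : orthonormal_basis L u ->
  (0 < n)%N ->
  (virasoro L u) _(0) (heis L g (- n%:Z) vac) = n%:R *: heis L g (- n.+1%:Z) vac.
Proof.
move=> uE n0; rewrite /vmode /Y /virasoro linearZ linear_sum /=.
have v0 h (q : int) : 0 <= q -> q != n -> heis L h q (heis L g (- n%:Z) vac) = 0.
  by move=> q0 /negbTE qn; rewrite heis_creation // qn mulr0 mul0r scale0r.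
rewrite (eq_bigr (fun i => (2 * n%:R) *: (lform L (u i) g *: heis L (u i) (- n.+1%:Z) vac))); last first.
  move=> i _; have := vmode_currents (u i) (u i) v0; rewrite /vmode /Y => ->.
  rewrite heis_creation // eqxx mulr1 linearZ /= -mulr2n -scaler_nat !scalerA.
  by rewrite mulrA.
rewrite -scaler_sumr scalerA mulrA mulVf ?natr_neq0 // mul1r; congr (_ *: _).
rewrite -[in RHS](sum_orthonormal g uE).
elim/big_rec2: _ => [|i x y _ ->]; first by rewrite heis0l.
by rewrite heis_linear.
Qed.

Lemma vmode_vexp a b : lform L a b = 0 ->
  (vexp a) _(-1) (vexp b) = (eps a b)%:~R *: vexp (a + b).
Proof.
move=> ab0; rewrite /vmode /Y linextU /Ykey /= enum_mset0 /= opprK subrr.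
have := @Yexp_vexp C r L eps a b 1 0.
by rewrite ab0 eqxx mul1r scale1r; apply.
Qed.

(** In the normally ordered product of the k-th divided derivative of h(z) with
Y(e^a, z), applied to e^b, the constant term has a single source.  Nonnegative
powers from the current on the left would need powers of z below (a|b) from
Y(e^a, z) e^b, and there are none.  Negative powers on the right come from the
modes h(n), n >= 0, of which only h(0) is nonzero on e^b; it sits at
z^(-k-1) and meets the leading term z^(a|b) of Y(e^a, z). *)
Lemma vmode_hcre_vexp i k a b : lform L a b = k.+1 ->
  (hcre (i, k) (vexp a)) _(-1) (vexp b) =
  ((-1) ^+ k * lform L (hbasis C i) (lemb C b) * (eps a b)%:~R) *: vexp (a + b).
Proof.
move=> abk; rewrite vmode_hcre opprK subrr /nord /=; set A := fdivderiv _ _.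
have A0 q : A q 0 = 0 by exact: current0.
have Yb q : q < k.+1%:Z -> Yexp L eps a q (vexp b) = 0.
  move=> qk; have := @Yexp_vexp C r L eps a b 1 q.
  by rewrite scale1r abk (ltW qk) lt_eqF // => ->.
rewrite {1}/fmul fsbig1 ?add0r => [|q _]; last first.
  by case: ifP => // q0; rewrite Yb ?A0 //; lia.
have Ab q : q < 0 -> A q (vexp b) = if q == - k.+1%:Z then
    ((-1) ^+ k * lform L (hbasis C i) (lemb C b)) *: vexp b else 0.
  move=> q0; rewrite /A fdivderivE /current; case: eqP => [->|/eqP qk].
    rewrite (_ : - (- k.+1%:Z + k) - 1 = 0); last by lia.
    rewrite heis_vexp0 scalerA prod_fact.
    by rewrite rmorphM rmorphXn rmorphN1 /= mulrCA mulVf ?mulr1 // natr_neq0 -lt0n fact_gt0.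
  have [kq|kq] := ltP q (- k.+1%:Z).
    by rewrite heis_vexp_gt0 ?scaler0 //; lia.
  (* For -k-1 < q < 0 the current involves a creation mode, but differentiating
     a power z^p with 0 <= p < k more than p times gives 0. *)
  have jk : (`|q|.-1 < k)%N by lia.
  rewrite (bigD1 (Ordinal jk)) //= (_ : q + _ = 0); last by lia.
  by rewrite mul0r mulr0 scale0r.
rewrite /fmul (@fsum1 _ _ _ _ k.+1%:Z) => [|q qk].
  by rewrite /= Ab ?ifT ?Yexp_vexp ?abk ?eqxx //; lia.
case: ifP => q0; last exact: Yexp_0.
by rewrite Ab 1?ifF ?Yexp_0 //; lia.
Qed.

End Products.

(** * Reduction modulo C_1 *)

Section Quotient.
Variables (C : fieldType) (r : nat) (L : evenLattice r).
Variable eps : 'rV[int]_r -> 'rV[int]_r -> int.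
Variables (u : 'I_r -> 'rV[C]_r) (M : set 'rV[int]_r).
Hypothesis char0 : [pchar C] =i pred0.
Hypothesis eps_cocycle : is_cocycle L eps.
Hypothesis u_orthonormal : orthonormal_basis L u.
Hypothesis M_submonoid : submonoid M.
Local Notation V := (lvect C r).
Local Notation vac := (vac C r).
Local Notation vexp := (vexp C).
Local Notation VM := (lattice_subVOA L eps u M).
Implicit Types (a b : 'rV[int]_r) (v w : V) (k : vkey r).

(** Evenness makes the momentum part of the weight an integer, and positivity of
the form makes it positive for a nonzero momentum. *)
Lemma kweight_gt0 k : k != VKey mset0 0 ->
  exists2 n : nat, (0 < n)%N & kweight L k = n%:R.
Proof.
case: k => m a /=; rewrite /kweight /=; set s := (\sum_(x <- _) _)%N => ma0.
have /dvdzP[d dE] := gram_even L a; rewrite /lform dE intrM mulfK //.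
have d0 : a != 0 -> 0 < d by move=> /(gram_pos L); rewrite dE pmulr_lgt0.
have d0' : 0 <= d.
  have [a0|/d0/ltW //] := eqVneq a 0; move: dE.
  by rewrite a0 /gform !mul0mx mxE => /esym/eqP; rewrite mulf_eq0 orbF => /eqP ->.
exists (s + `|d|)%N; last by rewrite natrD -[in LHS](gez0_abs d0').
rewrite addn_gt0; case: (mset_0Vmem m) => [m0|[x xm]].
  by apply/orP; right; rewrite absz_gt0 gt_eqF // d0 //; apply: contraNneq ma0 => ->; rewrite m0.
by rewrite /s (big_rem x).
Qed.

Lemma vplus_key k : M (mom k) -> k != VKey mset0 0 -> vplus (V := VM) (<< k >> : V).
Proof.
move=> Mk k0; apply: lspan_sub; split.
  by move=> k'; rewrite msuppU oner_eq0 inE => /eqP ->.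
have [n n0 kn] := kweight_gt0 k0; exists n => //= k'.
by rewrite msuppU oner_eq0 inE => /eqP ->.
Qed.

Lemma C1_prod (v w : V) : vplus (V := VM) v -> vplus (V := VM) w ->
  C1 (V := VM) (vmode L eps v (-1) w).
Proof. by move=> v1 w1; apply: lspan_sub; left; exists v, w. Qed.

Lemma vplus_creation_vac i n : vplus (V := VM) (hcre (i, n) vac).
Proof.
rewrite hcreU; apply: vplus_key => /=; first by case: M_submonoid.
apply/eqP => /(congr1 (fun k => osc k (i, n))).
by rewrite /= mset1DE eqxx mset0E.
Qed.

Lemma C1_creation x v : vplus (V := VM) v -> C1 (V := VM) (hcre x v).
Proof.
case: x => i n v1; rewrite -(vmode_hcre_vac char0 eps_cocycle).
exact: C1_prod (vplus_creation_vac i n) v1.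
Qed.

(** The vacuum is not in V_+, so h(-n-1) 1 is out of reach of [C1_creation]; here
the summand L(-1) V_+ of C_1 does the work. *)
Lemma C1_derivative i n : (0 < n)%N -> C1 (V := VM) (hcre (i, n) vac).
Proof.
move=> n0; apply: (@lspan_scaleK _ _ _ n%:R); first by rewrite (natr_neq0 char0) -lt0n.
apply: lspan_sub; right; exists (hcre (i, n.-1) vac).
  exact: vplus_creation_vac.
rewrite /Lvir /= !(hcreE L) !NegzE prednK // virasoro_creation //.
Qed.

(** Up to a nonzero scalar, e^(a+b) is (e^a)_{-1} e^b if (a|b) = 0, and
(h(-k-1) e^a)_{-1} e^b if (a|b) = k + 1, where h is a basis vector not
orthogonal to b. *)
Lemma C1_vexpD a b : M a -> M b -> a != 0 -> b != 0 -> 0 <= lform L a b ->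
  C1 (V := VM) (vexp (a + b)).
Proof.
move=> Ma Mb a0 b0 ab0.
have [eps1 _ _ _] := eps_cocycle.
have e0 : (eps a b)%:~R != 0 :> C.
  by case: (eps1 a b) => ->; rewrite ?rmorphN ?oppr_eq0 oner_neq0.
have nvac m c : c != 0 -> VKey m c != VKey mset0 (0 : 'rV[int]_r).
  by move=> c0; apply: contra c0 => /eqP[_ ->].
have vb : vplus (V := VM) (vexp b) by apply: vplus_key => //; exact: nvac.
case abk : (lform L a b) ab0 => [[|k]|] // _.
  apply: lspan_scaleK e0 _; rewrite -(vmode_vexp C eps abk).
  by apply: C1_prod => //; apply: vplus_key => //; exact: nvac.
have [i bi] : exists i, lform L (hbasis C i) (lemb C b) != 0.
  apply: contrapT => H; have lb0 : 0 < lform L b b := gram_pos L b0.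
  have : (`|lform L b b|%N)%:R != 0 :> C by rewrite natr_neq0 // absz_eq0 gt_eqF.
  rewrite pmulrn gez0_abs ?(ltW lb0) // -lform_lemb lform_sum big1 ?eqxx // => i _.
  apply/eqP; rewrite mulf_eq0; apply/orP; right; rewrite lformC.
  by apply: contrapT => /negP bi; apply: H; exists i.
have abik : ((-1) ^+ k * lform L (hbasis C i) (lemb C b) * (eps a b)%:~R) != 0.
  by rewrite !mulf_neq0 // signr_eq0.
apply: lspan_scaleK abik _; rewrite -(vmode_hcre_vexp eps char0 _ abk).
by apply: C1_prod => //; rewrite hcreU; apply: vplus_key => //; exact: nvac.
Qed.

(** V_M is spanned modulo C_1 by 1, by the h(-1) 1 with h in a basis, and by the
e^a with a indecomposable. *)
Lemma C1_cofinite_indecomposables (F : seq 'rV[int]_r) :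
  (forall a, a \in F -> M a) ->
  (forall a, M a -> [\/ a = 0, a \in F | exists b,
     [/\ M b, M (a - b), b != 0, b != a & 0 <= lform L b (a - b)]]) ->
  C1_cofinite VM.
Proof.
move=> FM indec.
pose s : seq V := vac :: [seq hcre (i, 0%N) vac | i <- enum 'I_r] ++ [seq vexp a | a <- F].
have Mkey k : M (mom k) -> sectors M (<< k >> : V).
  by move=> Mk k'; rewrite msuppU oner_eq0 inE => /eqP ->.
exists s; split=> [x|v Mv].
  rewrite inE mem_cat => /or3P[/eqP ->|/mapP[i _ ->]|/mapP[a aF ->]].
  - by apply: Mkey; case: M_submonoid.
  - by rewrite hcreU; apply: Mkey; case: M_submonoid.
  - by apply: Mkey; exact: FM.
pose Q (v : V) := exists2 w : V, lspan [set x | x \in s] w & C1 (V := VM) (v - w).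
have QC v' : C1 (V := VM) v' -> Q v'.
  by move=> Cv; exists 0; [exact: lspan0 | rewrite subr0].
have Qs v' : v' \in s -> Q v'.
  by move=> vs; exists v'; [exact: lspan_sub | rewrite subrr; exact: lspan0].
have Qkey k : M (mom k) -> Q << k >>.
  case: k => m a /= Ma; case: (mset_0Vmem m) => [->|[x xm]].
    case: (indec a Ma) => [->|aF|[b [Mb Mc b0 ba bc]]].
    - by apply: Qs; rewrite inE eqxx.
    - by apply: Qs; rewrite inE mem_cat (map_f (@Defs.vexp C r) aF) !orbT.
    - apply: QC; rewrite -(subrKC b a); apply: C1_vexpD => //.
      by rewrite subr_eq0 eq_sym.
  have -> : << VKey m a >> = hcre x (<< VKey (m `\ x)%mset a >> : V).
    by rewrite hcreU /= msetB1K.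
  have [[-> ->]|ma0] := eqVneq (VKey (m `\ x)%mset a) (VKey mset0 0); last first.
    by apply: QC; apply: C1_creation; exact: vplus_key.
  case: x {xm} => i [|n].
    apply: Qs; rewrite inE mem_cat; apply/or3P; apply: Or32.
    by apply: map_f; rewrite mem_enum.
  by apply: QC; exact: C1_derivative.
change (Q v); rewrite [v]malg_sumE big_seq; elim/big_rec: _ => [|k w kv [w' sw' Cw]].
  by apply: QC; exact: lspan0.
have [k' sk Ck] := Qkey k (Mv k kv).
exists (v@_k *: k' + w'); first exact: lspanP.
by rewrite opprD addrACA -scalerBr; apply: lspanP.
Qed.

End Quotient.

(** * The submonoid P of the lattice A_2 *)

Section A2.
Implicit Types (v w : 'rV[int]_2).

Lemma row2P v w : v 0 0 = w 0 0 -> v 0 1 = w 0 1 -> v = w.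
Proof.
move=> vw0 vw1; apply/rowP => i; have [->//|i0] := eqVneq i 0.
by rewrite (_ : i = 1) //; apply: val_inj; case: i i0 => [[|[|i]]].
Qed.

Lemma row2_neq v w : (v 0 0 != w 0 0) || (v 0 1 != w 0 1) -> v != w.
Proof. by apply: contraTneq => ->; rewrite !eqxx. Qed.

Lemma A2_PE v : A2_P v <-> 0 <= v 0 1.
Proof.
split=> [[m [n ->]]|v0]; first by rewrite !mxE /= mulr0 add0r mulr1.
exists (v 0 0), (absz (v 0 1)); apply: row2P; rewrite !mxE /=.
  by rewrite mulr1 mulr0 addr0.
by rewrite mulr1 mulr0 add0r gez0_abs.
Qed.

Lemma A2_P_submonoid : submonoid A2_P.
Proof.
split=> [|x y]; rewrite !A2_PE ?mxE //; exact: addr_ge0.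
Qed.

Definition A2_borel : set 'rV[int]_2 :=
  [set v | 0 < v 0 1 \/ v 0 1 = 0 /\ 0 <= v 0 0].

Lemma A2_borel_type (R : realType) : borel_type R A2 A2_borel.
Proof.
split.
- split=> [|x y]; rewrite /A2_borel /= !mxE; first by right.
  by move: (x 0 0) (x 0 1) (y 0 0) (y 0 1) => *; lia.
- rewrite -subTset => v _.
  have [vB|vB] := pselect (A2_borel v); [by left | right].
  exists (- v); rewrite ?opprK //; move: vB; rewrite /A2_borel /= !mxE.
  by move: (v 0 0) (v 0 1) => *; lia.
- rewrite eqEsubset; split=> v /=.
    move=> [vB [w wB wv]]; move: vB; rewrite -wv /A2_borel /= !mxE => vB.
    by apply: row2P; rewrite !mxE; move: wB vB; rewrite /A2_borel /=;
      move: (w 0 0) (w 0 1) => *; lia.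
  move=> ->; have B0 : A2_borel 0 by right; rewrite !mxE.
  by split=> //; exists 0; rewrite ?oppr0.
(* alpha + 2 beta is orthogonal to alpha and has product 3 with beta. *)
exists (lemb R (A2_alpha + 2 *: A2_beta)).
  apply/eqP => /rowP/(_ 0); rewrite !mxE /= mulr0 addr0.
  by apply/eqP; rewrite oner_neq0.
move=> v vB; rewrite lform_lemb ler0z /lform A2_formE !mxE /=.
by move: vB; rewrite /A2_borel /=; move: (v 0 0) (v 0 1) => *; lia.
Qed.

Lemma A2_P_parabolic (R : realType) : parabolic_type R A2 A2_P.
Proof.
split; first exact: A2_P_submonoid.
exists A2_borel; first exact: A2_borel_type.
by move=> v; rewrite A2_PE; case=> [/ltW|[->]].
Qed.

Definition A2_indec := [:: A2_alpha; - A2_alpha; A2_beta; A2_alpha + A2_beta].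

(** With v = m alpha + n beta, splitting off beta is possible for n >= 2 when
(beta | v - beta) = 2 (n - 1) - m >= 0, and splitting off alpha or -alpha when
2 (m - 1) >= n or 2 (m + 1) <= n.  For n >= 2 the first two conditions cover
all m.  For n <= 1 the last two, with v different from alpha and -alpha to keep
both summands nonzero, leave only 0 and the listed vectors. *)
Lemma A2_P_split v : A2_P v -> [\/ v = 0, v \in A2_indec | exists b,
  [/\ A2_P b, A2_P (v - b), b != 0, b != v & 0 <= lform A2 b (v - b)]].
Proof.
rewrite A2_PE => n0.
have split (b : 'rV[int]_2) : 0 <= b 0 1 <= v 0 1 ->
    (b 0 0 != 0) || (b 0 1 != 0) -> (b 0 0 != v 0 0) || (b 0 1 != v 0 1) ->
    0 <= gform A2_gram b (v - b) ->
    exists b, [/\ A2_P b, A2_P (v - b), b != 0, b != v & 0 <= lform A2 b (v - b)].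
  move=> /andP[b0 bv] bn0 bnv gb; exists b; split=> //.
  - by rewrite A2_PE.
  - by rewrite A2_PE !mxE subr_ge0.
  - by apply: row2_neq; rewrite !mxE.
  - exact: row2_neq.
have [n2|n2] := leP 2 (v 0 1).
  have [mn|mn] := leP (v 0 0) (2 * v 0 1 - 2).
    by apply: Or33; apply: (split A2_beta); rewrite ?A2_formE !mxE /=; lia.
  by apply: Or33; apply: (split A2_alpha); rewrite ?A2_formE !mxE /=; lia.
have [m2|m2] := leP 2 (v 0 0).
  by apply: Or33; apply: (split A2_alpha); rewrite ?A2_formE !mxE /=; lia.
have [m1|m1] := leP (v 0 0) (- 2 + v 0 1).
  by apply: Or33; apply: (split (- A2_alpha)); rewrite ?A2_formE !mxE /=; lia.
have eqv w : v 0 0 = w 0 0 -> v 0 1 = w 0 1 -> v == w by move=> *; apply/eqP/row2P.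
have [n1|n1] := eqVneq (v 0 1) 1.
  apply: Or32; rewrite !inE; have [m0|m0] := eqVneq (v 0 0) 0.
    by rewrite [v == A2_beta]eqv ?orbT // !mxE.
  by rewrite [v == A2_alpha + _]eqv ?orbT // !mxE /=; lia.
have [m0|m0] := eqVneq (v 0 0) 0; first by apply: Or31; apply: row2P; rewrite mxE //; lia.
apply: Or32; rewrite !inE; have [m3|m3] := eqVneq (v 0 0) 1.
  by rewrite [v == A2_alpha]eqv // !mxE /=; lia.
by rewrite [v == - _]eqv ?orbT // !mxE /=; lia.
Qed.

End A2.

Theorem proposition5p4 (R : realType)
    (eps : 'rV[int]_2 -> 'rV[int]_2 -> int) (u : 'I_2 -> 'rV[R[i]%C]_2) :
  is_cocycle A2 eps -> orthonormal_basis A2 u ->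
  parabolic_type R A2 A2_P /\
  C1_cofinite (lattice_subVOA A2 eps u A2_P).
Proof.
move=> eps_cocycle u_orthonormal; split; first exact: A2_P_parabolic.
apply: (C1_cofinite_indecomposables _ eps_cocycle u_orthonormal A2_P_submonoid _ A2_P_split).
- exact: pchar_num.
- move=> a; rewrite !inE A2_PE => /or4P[] /eqP -> //; by rewrite !mxE.
Qed.
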